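(* Let $\mathfrak{A}\subseteq\mathcal{B}(\mathcal{H})$ be a transitive algebra and $n\in\mathbb{N}$. Then $\mathfrak{A}$ is $n$-fold transitive if and only if $\mathrm{Lat}\,\mathfrak{A}^{(n)}=\mathrm{Lat}\,\mathcal{B}(\mathcal{H})^{(n)}$, i.e., every projection $P\in M_n(\mathbb{C})\bar\otimes\mathcal{B}(\mathcal{H})$ with $P\in\mathrm{Lat}\,\mathfrak{A}^{(n)}$ satisfies $P\in M_n(\mathbb{C})\bar\otimes\mathbb{C}I$. Furthermore, the strong closure of $\mathfrak{A}$ is $\mathcal{B}(\mathcal{H})$ if and only if $\mathrm{Lat}\,\mathfrak{A}^{(n)}=\mathrm{Lat}\,\mathcal{B}(\mathcal{H})^{(n)}$ for every $n\in\mathbb{N}$.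
   Context: $\mathcal{H}$ is a complex Hilbert space. A subalgebra $\mathfrak{A}\subseteq\mathcal{B}(\mathcal{H})$ (not assumed self-adjoint or closed) is transitive if it contains the identity operator and has no invariant closed subspaces other than $\{0\}$ and $\mathcal{H}$. It is $n$-fold transitive if for any linearly independent $\xi_1,\dots,\xi_n\in\mathcal{H}$ the norm closure of $\{(S\xi_1,\dots,S\xi_n):S\in\mathfrak{A}\}$ is $\mathcal{H}^{(n)}$. Here $\mathcal{H}^{(n)}$ is the direct sum of $n$ copies of $\mathcal{H}$; $T^{(n)}$ is the direct sum of $n$ copies of $T$ acting on $\mathcal{H}^{(n)}$; $\mathfrak{A}^{(n)}=\{T^{(n)}:T\in\mathfrak{A}\}$ (also written $\mathbb{C}I_n\bar\otimes\mathfrak{A}$). $\mathcal{B}(\mathcal{H}^{(n)})$ is identified with $M_n(\mathbb{C})\bar\otimes\mathcal{B}(\mathcal{H})$, i.e. $n\times n$ matrices over $\mathcal{B}(\mathcal{H})$, and $M_n(\mathbb{C})\bar\otimes\mathbb{C}I$ are the matrices with scalar-operator entries. $\mathrm{Lat}$ of a set of operators is the collection of closed subspaces invariant under all of them; subspaces are identified with the orthogonal projections onto them, so $P\in\mathrm{Lat}\,T$ iff $PTP=TP$. *)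

(* Defs.v *)
From HB Require Import structures.
From mathcomp Require Import all_boot all_order all_algebra.
From mathcomp Require Import sesquilinear spectral complex.
From mathcomp Require Import all_classical all_reals all_analysis.

Set Implicit Arguments.
Unset Strict Implicit.
Unset Printing Implicit Defensive.
Import Order.TTheory GRing.Theory Num.Theory.

Local Open Scope classical_set_scope.
Local Open Scope complex_scope.
Local Open Scope ring_scope.

(* The inner product is linear in its first argument and conjugate-linear in
   the second one. *)
HB.mixin Record CompleteNormedModule_isHilbert (R : realType) H
    & CompleteNormedModule R[i] H := {
  inner : {dot H for Num.conj};
  inner_normE : forall x : H, inner x x = `|x| ^+ 2
}.

#[short(type="hilbertType")]
HB.structure Definition Hilbert (R : realType) :=
  {H of CompleteNormedModule R[i] H & CompleteNormedModule_isHilbert R H}.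

Definition dsum (T : Type) (n : nat) : Type := {ffun 'I_n -> T}.

Section DirectSumModule.
Variables (R : realType) (H : hilbertType R) (n : nat).
Local Notation C := R[i].
Implicit Types x y : dsum H n.

HB.instance Definition _ := GRing.Lmodule.copy (dsum H n) {ffun 'I_n -> H}.

Definition dsum_norm x : C := sqrtC (\sum_i `|x i| ^+ 2).

Let sum_sqr_ge0 x : 0 <= \sum_i `|x i| ^+ 2.
Proof. by apply: sumr_ge0 => i _; exact: exprn_ge0. Qed.

Lemma dsum_norm_ge0 x : 0 <= dsum_norm x.
Proof. by rewrite sqrtC_ge0. Qed.

Lemma dsum_normE x : dsum_norm x ^+ 2 = \sum_i `|x i| ^+ 2.
Proof. by rewrite sqrtCK. Qed.

(* Minkowski's inequality, from the one for row vectors in spectral *)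
Fact dsum_normD x y : dsum_norm (x + y) <= dsum_norm x + dsum_norm y.
Proof.
pose u (z : dsum H n) : 'rV[C]_n := \row_i `|z i|.
have uE z : dsum_norm z = sqrtC (dotmx (u z) (u z)).
  congr sqrtC; rewrite dotmxE mxE; apply: eq_bigr => i _.
  by rewrite !mxE geC0_conj// -expr2.
rewrite !uE; apply: le_trans (triangle_lerif (@dotmx _ _) (u x) (u y)).
rewrite ler_sqrtC ?qualifE/= ?dnorm_ge0// !dotmxE !mxE.
apply: ler_sum => i _.
rewrite !mxE ffunE !geC0_conj ?addr_ge0// -!expr2.
by rewrite lerXn2r ?qualifE/= ?addr_ge0// ler_normD.
Qed.

Fact dsum_normZ (a : C) x : dsum_norm (a *: x) = `|a| * dsum_norm x.
Proof.
rewrite /dsum_norm -[X in X * _]sqrCK// -sqrtCM ?qualifE/= ?exprn_ge0//.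
congr sqrtC; rewrite mulr_sumr; apply: eq_bigr => i _.
by rewrite ffunE normrZ exprMn.
Qed.

Fact dsum_norm_eq0 x : dsum_norm x = 0 -> x = 0.
Proof.
move=> /eqP; rewrite sqrtC_eq0 psumr_eq0; last by move=> i _; exact: exprn_ge0.
move=> /allP x0; apply/ffunP => i; rewrite ffunE; apply/eqP.
by have := x0 i (mem_index_enum _); rewrite expf_eq0/= normr_eq0.
Qed.

HB.instance Definition _ :=
  Lmodule_isNormed.Build C (dsum H n) dsum_normD dsum_normZ dsum_norm_eq0.

Lemma dsum_coord_le x i : `|x i| <= `|x|.
Proof.
rewrite -(@ler_pXn2r _ 2) ?qualifE/= ?normr_ge0//.
by rewrite [leRHS]dsum_normE (bigD1 i)//= lerDl sumr_ge0// => j _; exact: exprn_ge0.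
Qed.

Lemma dsum_norm_le_sum x : `|x| <= \sum_i `|x i|.
Proof.
have s0 : 0 <= \sum_i `|x i| by exact: sumr_ge0.
rewrite -(@ler_pXn2r _ 2) ?qualifE/= ?normr_ge0// [leLHS]dsum_normE.
rewrite [leRHS]expr2 mulr_suml; apply: ler_sum => i _.
by rewrite expr2 ler_wpM2l// (bigD1 i)//= lerDl sumr_ge0.
Qed.

Fact dsum_complete (F : set_system (dsum H n)) :
  ProperFilter F -> cauchy F -> cvg F.
Proof.
move=> FF /cauchy_ballP Fc.
have Fi i : cvg ((fun x : dsum H n => x i) @ F).
  apply: cauchy_cvg; apply/cauchy_ballP => e e0.
  have [[A B] /= [FA FB] AB] := Fc e e0.
  exists ((fun x : dsum H n => x i) @` A, (fun x : dsum H n => x i) @` B).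
    by split => /=; [apply: filterS FA | apply: filterS FB] => x ?; exists x.
  move=> [_ _] /= [[x Ax <-] [y By <-]].
  have := AB (x, y) (conj Ax By); rewrite -!ball_normE/=.
  apply: le_lt_trans.
  by have := dsum_coord_le (x - y) i; rewrite !ffunE.
pose l : dsum H n := [ffun i => lim ((fun x : dsum H n => x i) @ F)].
apply/cvg_ex; exists l; apply/cvgrPdist_lt => e e0.
have d0 : 0 < e / n.+1%:R by rewrite divr_gt0.
have : F [set x : dsum H n | forall i, `|l i - x i| < e / n.+1%:R].
  apply: filter_forall => i; move/cvgrPdist_lt: (Fi i) => /(_ _ d0).
  by apply: filterS => x; rewrite ffunE.
apply: filterS => x xl; apply: le_lt_trans (dsum_norm_le_sum _) _.
apply: (@le_lt_trans _ _ (\sum_(i < n) e / n.+1%:R)).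
  by apply: ler_sum => i _; have := xl i; rewrite !ffunE => /ltW.
rewrite sumr_const card_ord -[ltLHS]mulr_natr -mulrA gtr_pMr// mulrC.
by rewrite ltr_pdivrMr// mul1r ltr_nat.
Qed.

HB.instance Definition _ := Uniform_isComplete.Build (dsum H n) dsum_complete.

Definition dsum_inner x y : C := \sum_i inner (x i) (y i).

Fact dsum_inner_bilinear :
  bilinear_for *%R (Num.conj \; *%R) dsum_inner.
Proof.
split=> [y a u v|x a u v]; rewrite /dsum_inner/= mulr_sumr -big_split/=;
  apply: eq_bigr => i _; rewrite !ffunE.
  by rewrite linearPl.
by rewrite linearPr.
Qed.

HB.instance Definition _ := bilinear_isBilinear.Build C (dsum H n) (dsum H n) C
  *%R (Num.conj \; *%R) dsum_inner dsum_inner_bilinear.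

Fact dsum_inner_herm x y :
  dsum_inner x y = (-1) ^+ false * Num.conj (dsum_inner y x).
Proof.
rewrite expr0 mul1r raddf_sum; apply: eq_bigr => i _.
by rewrite hermC expr0 mul1r.
Qed.

HB.instance Definition _ := isHermitianSesquilinear.Build C (dsum H n) false
  Num.conj dsum_inner dsum_inner_herm.

Fact dsum_inner_normE x : dsum_inner x x = `|x| ^+ 2.
Proof.
by rewrite [RHS]dsum_normE; apply: eq_bigr => i _; rewrite inner_normE.
Qed.

Fact dsum_inner_gt0 x : x != 0 -> 0 < dsum_inner x x.
Proof. by move=> x0; rewrite dsum_inner_normE exprn_gt0// normr_gt0. Qed.

HB.instance Definition _ := isDotProduct.Build C (dsum H n) dsum_inner
  dsum_inner_gt0.

HB.instance Definition _ := CompleteNormedModule_isHilbert.Build R (dsum H n)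
  dsum_inner_normE.

End DirectSumModule.

Section Operators.
Variables (R : realType) (H : hilbertType R).

Definition bounded_op : set (H -> H) :=
  [set T | linear T /\ exists M : R, forall x, `|T x| <= M%:C * `|x|].

Definition scalar_op : set (H -> H) :=
  [set T | exists a : R[i], T = (fun x => a *: x)].

Definition projection : set (H -> H) :=
  [set P | [/\ bounded_op P, P \o P = P &
               forall x y, inner (P x) y = inner x (P y)]].

Definition closed_subspace : set (set H) :=
  [set M | [/\ M 0,
               forall (a : R[i]) x y, M x -> M y -> M (a *: x + y) &
               closed M]].

Definition Lat (F : set (H -> H)) : set (set H) :=
  [set M | closed_subspace M /\ forall T, F T -> T @` M `<=` M].

(* the same lattice, subspaces being replaced by the projections onto them *)
Definition Lat_proj (F : set (H -> H)) : set (H -> H) :=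
  [set P | projection P /\ forall T, F T -> P \o T \o P = T \o P].

Record subalgebra (A : set (H -> H)) : Prop := Subalgebra {
  subalgebra_bounded : A `<=` bounded_op;
  subalgebra0 : A (fun=> 0);
  subalgebraP : forall (a : R[i]) S T,
    A S -> A T -> A (fun x => a *: S x + T x);
  subalgebraM : forall S T, A S -> A T -> A (S \o T)
}.

Definition transitive_algebra (A : set (H -> H)) : Prop :=
  [/\ subalgebra A, A id &
      forall M, Lat A M -> M = [set 0] \/ M = setT].

(* The strong operator topology is the topology of pointwise convergence. *)
Definition strong_closure (A : set (H -> H)) : set (H -> H) :=
  bounded_op `&` @closure {ptws H -> H} A.

Definition lin_indep (n : nat) (x : dsum H n) : Prop :=
  forall a : 'I_n -> R[i], \sum_i a i *: x i = 0 -> forall i, a i = 0.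

(* the operator matrix (A i j) acting on the direct sum *)
Definition opmx (n : nat) (A : 'I_n -> 'I_n -> H -> H) (x : dsum H n) :
    dsum H n :=
  [ffun i => \sum_j A i j (x j)].

Definition opmx_over (n : nat) (D : set (H -> H)) :
    set (dsum H n -> dsum H n) :=
  [set opmx A | A in [set A | forall i j, D (A i j)]].

Definition ampl (n : nat) (T : H -> H) (x : dsum H n) : dsum H n :=
  [ffun i => T (x i)].

Definition n_fold_transitive (n : nat) (A : set (H -> H)) : Prop :=
  forall x : dsum H n, lin_indep x -> closure [set ampl S x | S in A] = setT.

End Operators.

Arguments bounded_op {R} H.
Arguments scalar_op {R} H.
Arguments opmx_over {R H} n D.
Arguments ampl {R H} n T x.

Section OperatorMatrices.
Variables (R : realType) (H : hilbertType R) (n : nat).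

Let lin0 (K L : lmodType R[i]) (T : K -> L) : linear T -> T 0 = 0.
Proof. by move=> lT; have := lT (-1) 0 0; rewrite scaler0 addr0 scaleN1r addNr. Qed.

Let linD (K L : lmodType R[i]) (T : K -> L) :
  linear T -> {morph T : x y / x + y}.
Proof. by move=> lT x y; have := lT 1 x y; rewrite !scale1r. Qed.

Let lin_sum (K L : lmodType R[i]) (T : K -> L) (x : 'I_n -> K) :
  linear T -> T (\sum_i x i) = \sum_i T (x i).
Proof. by move=> lT; exact: (big_morph T (linD lT) (lin0 lT)). Qed.

Let single (j : 'I_n) (x : H) : dsum H n := [ffun k => if k == j then x else 0].

Let singleP j a x y : single j (a *: x + y) = a *: single j x + single j y.
Proof.
by apply/ffunP => k; rewrite !ffunE; case: eqP; rewrite ?scaler0 ?addr0.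
Qed.

Let sum_single (x : dsum H n) : x = \sum_j single j (x j).
Proof.
apply/ffunP => k; rewrite sum_ffunE (bigD1 k)//= big1 ?addr0 => [|j jk].
  by rewrite ffunE eqxx.
by rewrite ffunE eq_sym (negbTE jk).
Qed.

Let norm_single j x : `|single j x| = `|x|.
Proof.
apply/eqP; rewrite -(@eqrXn2 _ 2)//.
rewrite [`|single _ _| ^+ 2]dsum_normE (bigD1 j)//= big1 ?addr0 => [|k kj].
  by rewrite ffunE eqxx.
by rewrite ffunE (negbTE kj) normr0 expr0n.
Qed.

Let bound_ge0 (K L : normedModType R[i]) (T : K -> L) :
  (exists M : R, forall x, `|T x| <= M%:C * `|x|) ->
  exists M : R, 0 <= M /\ forall x, `|T x| <= M%:C * `|x|.
Proof.
move=> [M TM]; exists `|M|; split=> // x; apply: le_trans (TM x) _.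
by rewrite ler_wpM2r// lecR ler_norm.
Qed.

(* the identification of B(H^(n)) with the matrices over B(H) *)
Lemma opmx_over_bounded_op :
  opmx_over n (bounded_op H) = bounded_op (dsum H n).
Proof.
apply/seteqP; split=> [_ [A /= Ab <-]|T [lT /bound_ge0 [M [M0 TM]]]].
  split=> [a x y|].
    apply/ffunP => i; rewrite !ffunE scaler_sumr -big_split/=.
    by apply: eq_bigr => j _; rewrite !ffunE (proj1 (Ab i j)).
  pose m i j := projT1 (cid (bound_ge0 (proj2 (Ab i j)))).
  have m0 i j : 0 <= m i j by rewrite /m; case: cid => ? [].
  have mP i j x : `|A i j x| <= (m i j)%:C * `|x|.
    by rewrite /m; case: cid => ? [].
  exists (\sum_i \sum_j m i j) => x.
  apply: le_trans (dsum_norm_le_sum _) _.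
  rewrite rmorph_sum mulr_suml; apply: ler_sum => i _.
  rewrite ffunE rmorph_sum mulr_suml; apply: le_trans (ler_norm_sum _ _ _) _.
  apply: ler_sum => j _; apply: le_trans (mP _ _ _) _.
  by rewrite ler_wpM2l ?lecR ?m0// dsum_coord_le.
exists (fun i j x => T (single j x) i).
  move=> i j; split=> [a x y|]; first by rewrite singleP lT !ffunE.
  exists M => x; apply: le_trans (dsum_coord_le _ _) _.
  by rewrite -(norm_single j x).
apply/funext => x; apply/ffunP => i.
by rewrite ffunE {2}(sum_single x) (lin_sum _ lT) sum_ffunE.
Qed.

End OperatorMatrices.

(* Main.v *)
(** An operator [T] satisfies [T x_i = lim S x_i] jointly in [i] iff
    [T^(n) x] lies in the closure of the orbit [A^(n) x]. This closure is the
    least element of [Lat A^(n)] containing [x], so [Lat A^(n) = Lat B(H)^(n)]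
    says exactly that every bounded [T] maps every [x] into the closed orbit
    of [x]; quantified over [n], this is strong density. On independent
    tuples, finite-rank operators turn it into [n]-fold transitivity.
    Conversely, an arbitrary [n]-tuple is a scalar matrix applied to an
    independent one, and scalar matrices commute with amplifications; if [H]
    is too small to contain [n] independent vectors, the missing input is
    Burnside's theorem, obtained from Jacobson density and Schur's lemma.
    Finally, a projection whose range is invariant under all [T^(n)], in
    particular under the rank-one ones and their adjoints, commutes with them,
    so its entries commute with rank-one operators and are scalars. *)
Require Import Defs.
From mathcomp Require Import all_boot all_order all_algebra.
From mathcomp Require Import sesquilinear complex.
From mathcomp Require Import all_classical all_reals all_analysis.
From mathcomp Require Import ring lra.

Set Implicit Arguments.
Unset Strict Implicit.
Unset Printing Implicit Defensive.
Import Order.TTheory GRing.Theory Num.Theory.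
Import numFieldNormedType.Exports.

Local Open Scope classical_set_scope.
Local Open Scope ring_scope.

(** * Inner product identities and the Cauchy-Schwarz inequality *)

Section InnerProduct.
Variables (R : realType) (H : hilbertType R).
Local Notation C := R[i].
Implicit Types (x y z w : H) (a : C).

Lemma innerDl x y z : inner (x + y) z = inner x z + inner y z.
Proof. exact: linearDl. Qed.

Lemma innerBl x y z : inner (x - y) z = inner x z - inner y z.
Proof. exact: linearBl. Qed.

Lemma innerZl a x z : inner (a *: x) z = a * inner x z.
Proof. exact: linearZl_LR. Qed.

Lemma innerBr x y z : inner z (x - y) = inner z x - inner z y.
Proof. exact: linearBr. Qed.

Lemma innerZr a x z : inner z (a *: x) = Num.conj a * inner z x.
Proof. exact: linearZr_LR. Qed.

Lemma innerC x y : inner x y = Num.conj (inner y x).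
Proof. by rewrite hermC expr0 mul1r. Qed.

Lemma inner_suml n (F : 'I_n -> H) z :
  inner (\sum_i F i) z = \sum_i inner (F i) z.
Proof.
apply: (big_morph (fun x => inner x z)) => [x y|]; first exact: innerDl.
exact: linear0l.
Qed.

Lemma inner_eq0 x : inner x x = 0 -> x = 0.
Proof.
by rewrite inner_normE => /eqP; rewrite sqrf_eq0 normr_eq0 => /eqP.
Qed.

Lemma inner_inj x y :
  (forall z, inner x z = inner y z) -> x = y.
Proof.
move=> xy; apply/eqP; rewrite -subr_eq0; apply/eqP/inner_eq0.
by rewrite innerBl xy subrr.
Qed.

Lemma parallelogram x y :
  `|x + y| ^+ 2 + `|x - y| ^+ 2 = 2 * `|x| ^+ 2 + 2 * `|y| ^+ 2.
Proof.
rewrite -!inner_normE dnormD dnormB [LHS]addrACA subrr addr0.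
by rewrite -mulr2n mulr_natl mulr_natl mulrnDl.
Qed.

(** Pythagoras for the part of [x] orthogonal to [w]. Nonnegativity of the left side yields
    Cauchy-Schwarz; the exact value later shows that a nearest point leaves an orthogonal
    residual. *)
Lemma sqr_norm_residual x w : w != 0 ->
  `|x - (inner x w / `|w| ^+ 2) *: w| ^+ 2 =
  `|x| ^+ 2 - `|inner x w| ^+ 2 / `|w| ^+ 2.
Proof.
move=> w0; have n0 : `|w| ^+ 2 != 0 by rewrite sqrf_eq0 normr_eq0.
set t := _ / _; rewrite -inner_normE innerBl !innerBr !innerZl !innerZr.
rewrite [inner w x]innerC !inner_normE normCK.
have -> : Num.conj t = Num.conj (inner x w) / `|w| ^+ 2.
  by rewrite /t rmorphM fmorphV rmorphXn/= (geC0_conj (normr_ge0 w)).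
rewrite /t; field.
by rewrite normr_eq0.
Qed.

Lemma inner_norm_le x w : `|inner x w| <= `|x| * `|w|.
Proof.
have [->|w0] := eqVneq w 0; first by rewrite linear0r !normr0 mulr0.
have w2 : 0 < `|w| ^+ 2 by rewrite exprn_gt0 ?normr_gt0.
rewrite -(@ler_pXn2r _ 2) ?nnegrE ?mulr_ge0// exprMn -ler_pdivrMr//.
by rewrite -subr_ge0 -sqr_norm_residual// exprn_ge0.
Qed.

End InnerProduct.

(** * Bounded operators, finite-rank operators and linear subspaces *)

Section BoundedOperators.
Variables (R : realType).
Local Notation C := R[i].

Lemma closure_distP (K : normedModType C) (V : set K) x :
  closure V x <-> forall e : C, 0 < e -> exists2 y, V y & `|x - y| < e.
Proof.
split=> [cVx e e0|cV B /nbhs_ballP[e /= e0 eB]].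
  have [y [Vy]] := cVx _ (nbhsx_ballx x e e0).
  by rewrite -ball_normE; exists y.
have [y Vy xy] := cV e e0; exists y; split=> //.
by apply: eB; rewrite -ball_normE.
Qed.

Variable H : hilbertType R.
Implicit Types (T : H -> H) (x y z w : H) (a : C) (V : set H).

Lemma linD T : linear T -> {morph T : x y / x + y}.
Proof. by move=> lT x y; have := lT 1 x y; rewrite !scale1r. Qed.

Lemma lin0 T : linear T -> T 0 = 0.
Proof.
by move=> lT; have := lT (-1) 0 0; rewrite scaler0 addr0 scaleN1r addNr.
Qed.

Lemma linZ T a x : linear T -> T (a *: x) = a *: T x.
Proof. by move=> lT; have := lT a x 0; rewrite (lin0 lT) !addr0. Qed.

Lemma linB T x y : linear T -> T (x - y) = T x - T y.
Proof. by move=> lT; rewrite (linD lT) -scaleN1r linZ// scaleN1r. Qed.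

Lemma lin_sum T n (F : 'I_n -> H) : linear T -> T (\sum_i F i) = \sum_i T (F i).
Proof. by move=> lT; exact: (big_morph T (linD lT) (lin0 lT)). Qed.

Lemma bounded_opI T (M : C) :
  linear T -> 0 <= M -> (forall x, `|T x| <= M * `|x|) -> bounded_op H T.
Proof.
move=> lT M0 TM; split=> //; exists (complex.Re M) => x.
by rewrite (RRe_real (ger0_real M0)).
Qed.

Lemma bounded_opP T : bounded_op H T ->
  linear T /\ exists2 M : C, 0 < M & forall x, `|T x| <= M * `|x|.
Proof.
(* The given bound may be negative or zero; the absolute value plus one is positive, hence a
   legitimate divisor in continuity estimates. *)
move=> [lT [M TM]]; split=> //; exists (`|M|%:C + 1)%C.
  by rewrite ltr_wpDl// lecR.
move=> x; apply: le_trans (TM x) _; rewrite ler_wpM2r//.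
by rewrite ler_wpDr// lecR ler_norm.
Qed.

Lemma bounded_op_continuous T : bounded_op H T -> continuous T.
Proof.
move=> /bounded_opP[lT [M M0 TM]] x.
apply/cvgrPdist_lt => e e0; near=> y.
rewrite -linB//; apply: le_lt_trans (TM _) _.
rewrite mulrC -ltr_pdivlMr//; near: y.
by apply: cvgr_dist_lt; [exact: cvg_id|rewrite divr_gt0].
Unshelve. all: by end_near. Qed.

Lemma closure_image_bounded T V x :
  bounded_op H T -> closure V x -> closure (T @` V) (T x).
Proof.
move=> bT Vx B /(bounded_op_continuous bT) /Vx[y [Vy Ty]].
by exists (T y); split=> //; exists y.
Qed.

Lemma fixpoints_closed T :
  bounded_op H T -> closed [set x | T x = x].
Proof.
move=> bT; rewrite (_ : [set _ | _] = (fun x => T x - x) @^-1` [set 0]).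
  apply: closed_comp => [x _|].
    by apply: cvgB; [exact: bounded_op_continuous|exact: cvg_id].
  exact/accessible_closed_set1/hausdorff_accessible/norm_hausdorff.
by apply/seteqP; split=> x /= /eqP Tx; apply/eqP; rewrite subr_eq0 in Tx *.
Qed.

Lemma bounded_op0 : bounded_op H (fun=> 0).
Proof.
apply: (@bounded_opI _ 0) => // [a x y|x]; first by rewrite scaler0 addr0.
by rewrite normr0 mul0r.
Qed.

Lemma scalar_bounded a : bounded_op H (fun x => a *: x).
Proof.
apply: (@bounded_opI _ `|a|) => // [b x y|x]; last by rewrite normrZ.
by rewrite scalerDr !scalerA mulrC.
Qed.

Definition finite_rank n (w y : dsum H n) (x : H) : H :=
  \sum_i inner x (w i) *: y i.

Lemma finite_rank_bounded n (w y : dsum H n) : bounded_op H (finite_rank w y).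
Proof.
apply: (@bounded_opI _ (\sum_i `|w i| * `|y i|)).
- move=> a x z; rewrite /finite_rank scaler_sumr -big_split/=.
  by apply: eq_bigr => i _; rewrite innerDl innerZl scalerDl scalerA.
- by apply: sumr_ge0 => i _; rewrite mulr_ge0.
move=> x; apply: le_trans (ler_norm_sum _ _ _) _; rewrite mulr_suml.
apply: ler_sum => i _; rewrite normrZ [leRHS]mulrAC ler_wpM2r//.
by rewrite mulrC inner_norm_le.
Qed.

Definition rank_one (u v x : H) : H := inner x u *: v.

Lemma rank_one_bounded u v : bounded_op H (rank_one u v).
Proof.
have := finite_rank_bounded ([ffun=> u] : dsum H 1) [ffun=> v].
congr bounded_op; apply/funext => x.
by rewrite /finite_rank big_ord1 !ffunE.
Qed.

(** Applying [T] to [rank_one u v u] gives [inner u u *: T v = inner (T u) u *: v] for every [v], so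
    any nonzero [u] determines the scalar. On the zero space the scalar [0] serves. *)
Lemma rank_one_commutant_scalar T : linear T ->
  (forall u v x, T (rank_one u v x) = rank_one u v (T x)) -> scalar_op H T.
Proof.
move=> lT TC; have [[u u0]|nz] := pselect (exists u : H, u != 0).
  exists (inner (T u) u / `|u| ^+ 2); apply/funext => v.
  have := TC u v u; rewrite /rank_one linZ// inner_normE => Tv.
  by rewrite mulrC -scalerA -Tv scalerA mulVf ?scale1r// sqrf_eq0 normr_eq0.
exists 0; apply/funext => v; rewrite scale0r; apply/eqP/negP => /negP Tv.
by apply: nz; exists (T v).
Qed.

(** Closedness is left out so that orbits, which are merely linear, are covered. *)
Definition lin_subspace V :=
  V 0 /\ forall a x y, V x -> V y -> V (a *: x + y).

Lemma subspaceD V x y : lin_subspace V -> V x -> V y -> V (x + y).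
Proof. by move=> [_ VP] Vx Vy; rewrite -[x]scale1r; exact: VP. Qed.

Lemma subspaceZ V a x : lin_subspace V -> V x -> V (a *: x).
Proof. by move=> [V0 VP] Vx; rewrite -[_ *: _]addr0; exact: VP. Qed.

Lemma subspaceB V x y : lin_subspace V -> V x -> V y -> V (x - y).
Proof. by move=> [V0 VP] Vx Vy; rewrite addrC -scaleN1r; exact: VP. Qed.

Lemma subspace_sum V n (a : 'I_n -> C) (x : 'I_n -> H) :
  lin_subspace V -> (forall i, V (x i)) -> V (\sum_i a i *: x i).
Proof.
move=> sV Vx; apply: big_ind => [|u v Vu Vv|i _].
- exact: sV.1.
- exact: subspaceD.
- exact: subspaceZ.
Qed.

Lemma subspace_closure V : lin_subspace V -> lin_subspace (closure V).
Proof.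
move=> sV; split; first exact: subset_closure sV.1.
move=> a x y /closure_distP cx /closure_distP cy.
apply/closure_distP => e e0.
(* Adding one keeps the divisor nonzero when [a = 0]. *)
have a0 : 0 < `|a| + 1 by rewrite ltr_wpDl.
have [u Vu xu] := cx (e / 2 / (`|a| + 1)) ltac:(by rewrite !divr_gt0).
have [v Vv yv] := cy (e / 2) ltac:(by rewrite divr_gt0).
exists (a *: u + v); first exact: sV.2.
rewrite opprD addrACA -scalerBr [ltRHS]splitr.
apply: le_lt_trans (ler_normD _ _) _; apply: ltr_leD; last exact: ltW.
rewrite normrZ; apply: le_lt_trans (_ : _ <= (`|a| + 1) * `|x - u|) _.
  by rewrite ler_wpM2r// lerDl.
by rewrite mulrC -ltr_pdivlMr.
Qed.

End BoundedOperators.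

(** * Finite families: independence, spans, dual families, finite dimension *)

Section FiniteFamilies.
Variables (R : realType) (H : hilbertType R).
Local Notation C := R[i].
Implicit Types (v : H) (V : set H).

Definition span_of n (x : dsum H n) : set H :=
  [set v | exists a : 'I_n -> C, v = \sum_i a i *: x i].

Definition dcons n v (x : dsum H n) : dsum H n.+1 :=
  [ffun i => oapp x v (unlift ord0 i)].

Lemma dcons0 n v (x : dsum H n) : dcons v x ord0 = v.
Proof. by rewrite ffunE unlift_none. Qed.

Lemma dconsS n v (x : dsum H n) i : dcons v x (lift ord0 i) = x i.
Proof. by rewrite ffunE liftK. Qed.

Lemma span_of_subspace n (x : dsum H n) : lin_subspace (span_of x).
Proof.
split; first by exists (fun=> 0); rewrite big1// => i _; rewrite scale0r.
move=> a _ _ [b ->] [c ->]; exists (fun i => a * b i + c i).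
rewrite scaler_sumr -big_split/=; apply: eq_bigr => i _.
by rewrite scalerDl scalerA.
Qed.

Lemma span_of_gen n (x : dsum H n) i : span_of x (x i).
Proof.
exists (fun j => (j == i)%:R); rewrite (bigD1 i)//= eqxx scale1r big1 ?addr0//.
by move=> j /negbTE ->; rewrite scale0r.
Qed.

Lemma span_of_sub n (x : dsum H n) V :
  lin_subspace V -> (forall i, V (x i)) -> span_of x `<=` V.
Proof. by move=> sV Vx _ [a ->]; exact: subspace_sum. Qed.

Lemma span_of_trans m n (x : dsum H m) (y : dsum H n) :
  (forall i, span_of y (x i)) -> span_of x `<=` span_of y.
Proof. by move=> xy; apply: span_of_sub xy; exact: span_of_subspace. Qed.

Lemma lin_indep_cons n v (x : dsum H n) :
  lin_indep x -> ~ span_of x v -> lin_indep (dcons v x).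
Proof.
move=> ix xv a; rewrite big_ord_recl dcons0.
under eq_bigr do rewrite dconsS.
move=> a0; have a00 : a ord0 = 0.
  apply/eqP/negP => /negP nz; apply: xv.
  exists (fun i => - (a ord0)^-1 * a (lift ord0 i)).
  under eq_bigr do rewrite -scalerA.
  rewrite -scaler_sumr; move/eqP: a0; rewrite addrC addr_eq0 => /eqP ->.
  by rewrite scalerN scaleNr opprK scalerA mulVf// scale1r.
move=> i; case: (unliftP ord0 i) => [j|] ->//.
by apply: (ix (fun j => a (lift ord0 j))); rewrite a00 scale0r add0r in a0.
Qed.

Lemma lin_indep_tail n v (x : dsum H n) :
  lin_indep (dcons v x) -> lin_indep x /\ ~ span_of x v.
Proof.
move=> ivx; split=> [a ax i|[a va]].
  have := ivx (fun j => oapp a 0 (unlift ord0 j)); rewrite big_ord_recl.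
  rewrite unlift_none/= scale0r add0r.
  under eq_bigr do rewrite liftK dconsS.
  by move=> /(_ ax (lift ord0 i)); rewrite liftK.
(* The coefficient [-1] on the head [v] turns [v = \sum_i a i *: x i] into a vanishing
   combination. *)
have := ivx (fun j => oapp a (-1) (unlift ord0 j)); rewrite big_ord_recl.
rewrite unlift_none/= dcons0 scaleN1r.
under eq_bigr do rewrite liftK dconsS.
rewrite -va addNr => /(_ erefl ord0)/eqP.
by rewrite unlift_none/= oppr_eq0 oner_eq0.
Qed.

(** The matrix of coefficients of [x] over [y] has independent rows, so its rank is [m], which
    cannot exceed its [n] columns. *)
Lemma lin_indep_size m n (x : dsum H m) (y : dsum H n) :
  lin_indep x -> (forall i, span_of y (x i)) -> (m <= n)%N.
Proof.
move=> ix /choice[c xc]; pose M : 'M[C]_(m, n) := \matrix_(i, j) c i j.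
suff /eqP <- : row_free M by exact: rank_leq_col.
apply: inj_row_free => v vM; apply/rowP => i; rewrite mxE.
apply: (ix (fun i => v 0 i)); under eq_bigr do rewrite xc scaler_sumr.
rewrite exchange_big/= big1// => j _.
have /rowP/(_ j) := vM; rewrite !mxE => vMj.
under eq_bigr do rewrite scalerA.
rewrite -scaler_suml (_ : \sum_i _ = 0) ?scale0r// -[RHS]vMj.
by apply: eq_bigr => k _; rewrite mxE.
Qed.

(** The Gram matrix [G] is invertible: a row vector in its left kernel gives a combination of the
    [x i] orthogonal to every [x j], hence to itself, hence zero. *)
Lemma dual_family n (x : dsum H n) : lin_indep x ->
  exists w : dsum H n, forall i j, inner (x i) (w j) = (i == j)%:R.
Proof.
move=> ix; pose G : 'M[C]_n := \matrix_(i, j) inner (x i) (x j).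
have Gu : G \in unitmx.
  rewrite -row_free_unit; apply: inj_row_free => v vG.
  apply/rowP => i; rewrite mxE; apply: (ix (fun i => v 0 i)).
  apply: inner_eq0; set s := \sum_i _.
  suff sx j : inner (x j) s = 0.
    by rewrite {1}/s inner_suml big1// => j _; rewrite innerZl sx mulr0.
  rewrite innerC; have /rowP/(_ j) := vG; rewrite !mxE => vGj.
  rewrite /s inner_suml (_ : \sum_i _ = 0) ?rmorph0// -[RHS]vGj.
  by apply: eq_bigr => k _; rewrite mxE innerZl.
(* The conjugates undo the conjugate-linearity of [inner] in its second argument, so that the
   pairings are the entries of [G *m invmx G]. *)
exists [ffun j => \sum_k Num.conj (invmx G k j) *: x k] => i j.
rewrite ffunE innerC inner_suml rmorph_sum.
have /matrixP/(_ i j) := mulmxV Gu; rewrite !mxE => <-.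
apply: eq_bigr => k _; rewrite innerZl rmorphM/= conjCK -innerC mulrC.
by rewrite [G i k]mxE.
Qed.

Lemma finite_rank_interp n (x w y : dsum H n) :
  (forall i j, inner (x i) (w j) = (i == j)%:R) ->
  forall i, finite_rank w y (x i) = y i.
Proof.
move=> xw i; rewrite /finite_rank (bigD1 i)//= xw eqxx scale1r big1 ?addr0//.
by move=> j ji; rewrite xw eq_sym (negbTE ji) scale0r.
Qed.

Lemma lin_eq_span n (x : dsum H n) (S T : H -> H) :
  linear S -> linear T -> (forall i, S (x i) = T (x i)) ->
  forall v, span_of x v -> S v = T v.
Proof.
move=> lS lT ST _ [a ->]; rewrite !lin_sum//; apply: eq_bigr => i _.
by rewrite !linZ// ST.
Qed.

(* Adjoin vectors of [V] outside the span until [n] of them are available or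
   they generate [V]. *)
Lemma extend_family n V k (y : dsum H k) :
  (k <= n)%N -> lin_indep y -> (forall i, V (y i)) ->
  exists m (z : dsum H m), [/\ lin_indep z, forall i, V (z i),
    forall i, span_of z (y i) & m = n \/ V `<=` span_of z].
Proof.
move=> /subnKC <-; move: (n - k)%N => d; elim: d k y => [|d IH] k y iy Vy.
  exists k, y; split=> //; first exact: span_of_gen.
  by left; rewrite addn0.
have [Vs|/existsNP[v /not_implyP[Vv yv]]] := pselect (V `<=` span_of y).
  by exists k, y; split=> //; [exact: span_of_gen|right].
have [|i|m [z [iz Vz zy mz]]] := IH _ (dcons v y).
- exact: lin_indep_cons.
- by case: (unliftP ord0 i) => [j|] ->; rewrite ?dconsS ?dcons0.
exists m, z; split=> //; last by rewrite addnS -addSn.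
by move=> i; rewrite -(dconsS v y).
Qed.

(** By induction on [n], a vector is adjoined only when it lies outside the span of those already
    kept. *)
Lemma reduce_family n (x : dsum H n) :
  exists k (y : dsum H k),
    [/\ (k <= n)%N, lin_indep y & forall i, span_of y (x i)].
Proof.
elim: n x => [|n IH] x.
  by exists 0%N, x; split=> // [a _ [] //|[] //].
have [k [y [kn iy xy]]] := IH [ffun i => x (lift ord0 i)].
have xyS i : span_of y (x (lift ord0 i)) by have := xy i; rewrite ffunE.
have [y0|y0] := pselect (span_of y (x ord0)).
  exists k, y; split=> //; first exact: leqW.
  by move=> i; case: (unliftP ord0 i) => [j|] ->.
exists k.+1, (dcons (x ord0) y); split=> //; first exact: lin_indep_cons.
move=> i; case: (unliftP ord0 i) => [j|] ->.
  apply: (span_of_trans _ (xyS j)) => l.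
  by rewrite -(dconsS (x ord0) y); exact: span_of_gen.
by rewrite -{2}(dcons0 (x ord0) y); exact: span_of_gen.
Qed.

(** A basis of [V] and its dual family define a bounded finite-rank operator whose fixed points are
    exactly [V]. *)
Lemma finite_dim_closed n (e : dsum H n) V :
  lin_subspace V -> V `<=` span_of e -> closed V.
Proof.
move=> sV Ve.
have ie : lin_indep ([ffun=> 0] : dsum H 0) by move=> a _ [].
(* The target size [n.+1] exceeds what [span_of e] can hold, so the extension must stop because it
   generates [V]. *)
have [|m [z [iz Vz _ mz]]] := extend_family (V := V) (leq0n n.+1) ie.
  by case.
have {mz} Vz' : V `<=` span_of z.
  case: mz => // mn; have := lin_indep_size iz (fun i => Ve _ (Vz i)).
  by move=> /leq_ltn_trans/(_ (ltnSn n)); rewrite {1}mn ltnn.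
have [w zw] := dual_family iz; pose Q := finite_rank w z.
have [lQ _] := finite_rank_bounded w z.
have QV v : V (Q v) by exact: subspace_sum.
have Qid v : V v -> Q v = v.
  move=> /Vz'; apply: (@lin_eq_span _ z Q id) => //.
  exact: finite_rank_interp.
have -> : V = [set v | Q v = v].
  by apply/seteqP; split=> [v /Qid|v /= <-].
exact/fixpoints_closed/finite_rank_bounded.
Qed.

End FiniteFamilies.

(** * Nearest points and orthogonal projections onto closed subspaces *)

Section Projections.
Variables (R : realType) (H : hilbertType R).
Local Notation C := R[i].
Implicit Types (x y z w p q : H) (a : C) (M : set H).

(** The norm takes values in [R[i]]; its real copy makes infima and real arithmetic available. *)
Let rn x : R := complex.Re `|x|.

Let rnE x : `|x| = (rn x)%:C%C.
Proof. by rewrite RRe_real// ger0_real. Qed.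

Let rn_ge0 x : 0 <= rn x.
Proof. by rewrite -lecR -rnE; exact: normr_ge0. Qed.

(** The parallelogram law makes the sets [B e] of near-minimizers shrink in diameter, so they
    generate a Cauchy filter; its limit stays in [M] and attains the infimum [d]. *)
Lemma nearest_point M x : closed_subspace M ->
  exists2 p, M p & forall y, M y -> `|x - p| <= `|x - y|.
Proof.
move=> [M0 MP Mc].
have sM : lin_subspace M by [].
pose D := [set rn (x - y) | y in M]; pose d := inf D.
have hD : has_inf D.
  by split; [exists (rn (x - 0)), 0|exists 0 => _ [y _ <-]].
have dle y : M y -> d <= rn (x - y).
  by move=> My; apply: ge_inf; [exact: hD.2|exists y].
have d0 : 0 <= d by apply: lb_le_inf => [|_ [y _ <-]//]; exact: hD.1.
pose B e := [set y | M y /\ rn (x - y) < d + e].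
have B0 e : 0 < e -> B e !=set0.
  by move=> e0; have [_ [y My <-] ye] := inf_adherent e0 hD; exists y.
(* the midpoint of [y] and [z] lies in [M], hence at distance at least [d] *)
have Bdiam e y z : 0 < e -> B e y -> B e z ->
    rn (y - z) ^+ 2 <= (8 * d + 4 * e) * e.
  move=> e0 [My ye] [Mz ze].
  have := parallelogram (x - y) (x - z).
  have -> : x - y - (x - z) = - (y - z) by rewrite !opprB addrC addrA subrK.
  have -> : x - y + (x - z) = (2 : C) *: (x - (2^-1 : C) *: (y + z)).
    rewrite scalerBr scalerA divff// scale1r scalerDl scale1r opprD.
    by rewrite addrACA.
  have := dle _ (subspaceZ (2^-1 : C) sM (subspaceD sM My Mz)).
  set m := x - _; rewrite normrN normrZ exprMn !rnE => dm.
  have -> : `|2 : C| ^+ 2 = (4 : R)%:C%C.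
    by rewrite ger0_norm// -natrX rmorph_nat.
  have -> : (2 : C) = (2 : R)%:C%C by rewrite rmorph_nat.
  rewrite -!rmorphXn -!rmorphM -!rmorphD => /complexI.
  move: dm (rn_ge0 (x - y)) (rn_ge0 (x - z)) ye ze.
  set s := rn (x - y); set t := rn (x - z); set u := rn (y - z); set r := rn m.
  move=> dr s0 t0 sd td rstu.
  have : d ^+ 2 <= r ^+ 2 by rewrite lerXn2r ?nnegrE// (le_trans d0).
  have : s ^+ 2 <= (d + e) ^+ 2.
    by rewrite lerXn2r ?nnegrE ?(ltW sd)// ltW// (le_lt_trans s0).
  have : t ^+ 2 <= (d + e) ^+ 2.
    by rewrite lerXn2r ?nnegrE ?(ltW td)// ltW// (le_lt_trans t0).
  by move=> *; lra.
pose F := filter_from [set e : R | 0 < e] B.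
have FF : ProperFilter F.
  apply: filter_from_proper => //.
  apply: filter_from_filter; first by exists 1 => /=.
  move=> e f e0 f0; exists (Num.min e f); first by rewrite /= lt_min e0.
  by move=> y [My ye]; split; split=> //; apply: lt_le_trans ye _;
    rewrite lerD2l ge_min lexx ?orbT.
have Fc : cauchy F.
  apply/cauchy_exP => e e0.
  have eE : e = (complex.Re e)%:C%C by rewrite RRe_real// gtr0_real.
  have e1 : 0 < complex.Re e by rewrite -ltcR -eE.
  (* Since [f <= 1], the bound [(8 * d + 4 * f) * f] is strictly below [(8 * d + 5) * f], which is
     at most the square of the radius. *)
  pose f := Num.min 1 (complex.Re e ^+ 2 / (8 * d + 5)).
  have c0 : 0 < 8 * d + 5 by lra.
  have f0 : 0 < f by rewrite lt_min ltr01 divr_gt0// exprn_gt0.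
  have [y By] := B0 f f0; exists y, f => // z Bz; rewrite -ball_normE/=.
  rewrite rnE eE ltcR -(@ltr_pXn2r _ 2) ?nnegrE ?(ltW e1)//.
  apply: le_lt_trans (Bdiam _ _ _ f0 By Bz) _.
  have : f <= 1 by rewrite ge_min lexx.
  have : f <= complex.Re e ^+ 2 / (8 * d + 5) by rewrite ge_min lexx orbT.
  by rewrite ler_pdivlMr// => *; nra.
have /cvg_ex[p Fp] : cvg F by exact: cauchy_cvg.
have Fball (e : C) f : 0 < e -> 0 < f -> exists2 y, B f y & `|p - y| < e.
  move=> e0 f0; have Bf : F (B f) by exists f.
  have pF : F (ball p e) by apply: Fp; exact: nbhsx_ballx.
  have [y [By]] := filter_ex (filterI Bf pF).
  by rewrite -ball_normE; exists y.
exists p.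
  apply: Mc; apply/closure_distP => e e0.
  by have [y [My _] py] := Fball e 1 e0 ltr01; exists y.
move=> y My; suff pd : rn (x - p) <= d by rewrite !rnE lecR (le_trans pd)// dle.
apply/ler_addgt0Pr => e e0; have e2 : 0 < e / 2 by rewrite divr_gt0.
have [|z [Mz xz] pz] := Fball (e / 2)%:C%C _ _ e2; first by rewrite ltcR.
rewrite [e]splitr addrA.
apply: le_trans (lerD (ltW xz) (_ : rn (p - z) <= _)); last first.
  by rewrite -lecR -rnE ltW.
have := ler_normD (x - z) (z - p).
by rewrite addrA subrK [`|z - p|]distrC !rnE -rmorphD lecR.
Qed.

(** Were [inner (x - p) w] nonzero, moving the nearest point [p] by the component of [x - p] along
    [w] would come strictly closer to [x]. *)
Lemma orthogonal_projection M x : closed_subspace M ->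
  exists2 p, M p & forall w, M w -> inner (x - p) w = 0.
Proof.
move=> cM; have [p Mp xp] := nearest_point x cM; exists p => // w Mw.
have sM : lin_subspace M by case: cM.
have [->|w0] := eqVneq w 0; first by rewrite linear0r.
have := xp _ (subspaceD sM Mp (subspaceZ (inner (x - p) w / `|w| ^+ 2) sM Mw)).
rewrite -(@ler_pXn2r _ 2) ?nnegrE// opprD addrA sqr_norm_residual//.
rewrite lerBrDl gerDr pmulr_lle0 ?invr_gt0 ?exprn_gt0 ?normr_gt0// => le0.
apply/eqP; rewrite -normr_eq0 -sqrf_eq0 eq_le le0/=.
by rewrite exprn_ge0.
Qed.

Lemma projection_onto M : closed_subspace M ->
  exists P, [/\ projection P, forall x, M (P x) & forall x, M x -> P x = x].
Proof.
move=> cM; have sM : lin_subspace M by case: cM.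
have /choice[P PP] x : exists p, M p /\ forall w, M w -> inner (x - p) w = 0.
  by have [p] := orthogonal_projection x cM; exists p.
have MP x : M (P x) := (PP x).1.
have orth x w : M w -> inner x w = inner (P x) w.
  by move=> Mw; apply/eqP; rewrite -subr_eq0 -innerBl (PP x).2.
(* [P x] is the only point of [M] having the same inner products as [x] against [M]; linearity and
   idempotence both follow from this. *)
have uniq x p : M p -> (forall w, M w -> inner x w = inner p w) -> P x = p.
  move=> Mp xp; apply/eqP; rewrite -subr_eq0; apply/eqP/inner_eq0.
  by rewrite innerBl -(orth x) ?xp ?subrr//; exact: subspaceB.
have Pid x : M x -> P x = x by move=> Mx; exact: uniq.
have lP : linear P.
  move=> a x y; apply: uniq; first exact: sM.2.
  by move=> w Mw; rewrite !innerDl !innerZl (orth x)// (orth y).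
exists P; split=> //; split=> [||x y].
- apply: (@bounded_opI _ _ _ 1) => // x; rewrite mul1r.
  have [->|Px0] := eqVneq (P x) 0; first by rewrite normr0.
  rewrite -(@ler_pM2r _ `|P x|) ?normr_gt0// -expr2 -inner_normE -(orth x)//.
  apply: le_trans (inner_norm_le x (P x)).
  by rewrite (orth x)// inner_normE ger0_norm ?exprn_ge0.
- by apply/funext => x /=; exact: Pid.
by rewrite innerC (orth y)// -innerC (orth x).
Qed.

End Projections.

(** * Burnside's theorem for transitive algebras in finite dimension *)

Section Burnside.
Variables (R : realType) (H : hilbertType R) (A : set (H -> H)).
Hypothesis tA : transitive_algebra A.
Local Notation C := R[i].
Implicit Types (x y z v : H) (S T : H -> H) (V : set H).

Let sA : subalgebra A. Proof. by case: tA. Qed.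

Let A_linear S : A S -> linear S.
Proof. by move=> /(subalgebra_bounded sA)[]. Qed.

Let A_id : A id. Proof. by case: tA. Qed.

Let A_add S T : A S -> A T -> A (fun x => S x + T x).
Proof.
move=> AS AT; have := subalgebraP sA 1 AS AT.
by under eq_fun do rewrite scale1r.
Qed.

Let A_sub S T : A S -> A T -> A (fun x => S x - T x).
Proof.
move=> AS AT; have := subalgebraP sA (-1) AT AS.
by under eq_fun do rewrite scaleN1r addrC.
Qed.

Let A_sum n (F : 'I_n -> H -> H) :
  (forall i, A (F i)) -> A (fun x => \sum_i F i x).
Proof.
elim: n F => [|n IH] F AF.
  under eq_fun do rewrite big_ord0; exact: subalgebra0.
under eq_fun do rewrite big_ord_recl.
by apply: A_add; [exact: AF|exact: IH].
Qed.

Variables (n : nat) (e : dsum H n).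
Hypothesis ie : lin_indep e.
Hypothesis spane : forall v, span_of e v.

(** Every subspace is closed in finite dimension, so transitivity also excludes invariant subspaces
    given only algebraically. *)
Lemma invariant_subspace_trivial V :
  lin_subspace V -> (forall S x, A S -> V x -> V (S x)) ->
  forall x, V x -> x != 0 -> forall y, V y.
Proof.
move=> sV VA x Vx x0 y; case: tA => _ _ /(_ V)[|V0|->//].
  split; last by move=> S AS _ [z Vz <-]; exact: VA.
  case: (sV) => V0 VP; split=> //.
  exact: (finite_dim_closed (e := e)).
by move: Vx x0; rewrite V0 /= => ->; rewrite eqxx.
Qed.

Lemma orbit_full x : x != 0 -> forall y, exists2 S, A S & S x = y.
Proof.
move=> x0 y.
suff : [set S x | S in A] y by [].
apply: (@invariant_subspace_trivial _ _ _ x) => //; last by exists id.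
  split; first by exists (fun=> 0) => //; exact: subalgebra0.
  move=> a _ _ [S AS <-] [T AT <-].
  by exists (fun x => a *: S x + T x) => //; exact: subalgebraP.
by move=> S _ AS [T AT <-]; exists (S \o T) => //; exact: subalgebraM.
Qed.

(** Schur's lemma: [T] has an eigenvector because the complex numbers are algebraically closed, and
    its eigenspace is invariant under [A], hence everything. *)
Lemma commutant_scalar T : linear T -> (forall S x, A S -> T (S x) = S (T x)) ->
  exists a : C, forall x, T x = a *: x.
Proof.
move=> lT TA; have /choice[c Te] i : span_of e (T (e i)) by [].
(* For [n = 0] the characteristic polynomial is constant and has no root, but the space is zero and
   any scalar works. *)
have [n0|n0] := posnP n.
  exists 0 => x; rewrite scale0r; have [a ->] := spane (T x).
  by rewrite big1// => i _; have := ltn_ord i; rewrite [X in (_ < X)%N]n0.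
pose M : 'M[C]_n := \matrix_(i, j) c i j.
have /closed_rootP[a] : size (char_poly M) != 1%N.
  by rewrite size_char_poly eqSS -lt0n.
rewrite -eigenvalue_root_char => /eigenvalueP[v vM v0].
pose x := \sum_i v 0 i *: e i.
have x0 : x != 0.
  apply: contra_neq v0 => x0; apply/rowP => i; rewrite mxE.
  exact: (ie (a := fun i => v 0 i) x0).
have Tx : T x = a *: x.
  rewrite lin_sum// scaler_sumr.
  under eq_bigr do rewrite linZ// Te scaler_sumr.
  rewrite exchange_big/=; apply: eq_bigr => j _.
  under eq_bigr do rewrite scalerA.
  rewrite -scaler_suml scalerA; congr (_ *: _).
  have /rowP/(_ j) := vM; rewrite !mxE => <-.
  by apply: eq_bigr => k _; rewrite mxE.
exists a.
apply: (@invariant_subspace_trivial [set y | T y = a *: y] _ _ x) => //.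
  split=> [|b y z /= Ty Tz]; first by rewrite /= lin0// scaler0.
  by rewrite lT Ty Tz scalerDr !scalerA [a * b]mulrC.
by move=> S y AS /= Ty; rewrite TA// Ty (linZ _ _ (A_linear AS)).
Qed.

(* Jacobson density: were every operator of [A] killing [y] to kill [u] as
   well, then each [z |-> S u], for [S] sending [y i] to [z] and the other
   [y j] to [0], would be a well-defined operator in the commutant, hence a
   scalar [l i], and [u = \sum_i l i *: y i]. *)
Lemma annihilator_separates k (y : dsum H k) u :
  (forall z : dsum H k, exists2 S, A S & forall i, S (y i) = z i) ->
  ~ span_of y u -> exists2 S, A S & (forall i, S (y i) = 0) /\ S u != 0.
Proof.
move=> yA; apply: contra_notP => nS.
have K S : A S -> (forall i, S (y i) = 0) -> S u = 0.
  by move=> AS Sy; apply/eqP/negP => /negP Su; apply: nS; exists S.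
have same S T : A S -> A T -> (forall i, S (y i) = T (y i)) -> S u = T u.
  move=> AS AT ST; apply/eqP; rewrite -subr_eq0; apply/eqP.
  apply: (K (fun x => S x - T x)); first exact: A_sub.
  by move=> i; rewrite ST subrr.
pose d i z : dsum H k := [ffun j => if j == i then z else 0].
have /choice[F FP] (p : 'I_k * H) :
    exists S, A S /\ forall j, S (y j) = d p.1 p.2 j.
  by have [S] := yA (d p.1 p.2); exists S.
have AF i z : A (F (i, z)) by have [] := FP (i, z).
have Fy i z j : F (i, z) (y j) = if j == i then z else 0.
  by have [_ /(_ j)] := FP (i, z); rewrite ffunE.
have /choice[l lP] i : exists a : C, forall z, F (i, z) u = a *: z.
  apply: commutant_scalar => [a z w|S z AS].
    apply: (same _ (fun x => a *: F (i, z) x + F (i, w) x)) => // [|j].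
      exact: subalgebraP.
    by rewrite !Fy; case: eqP; rewrite ?scaler0 ?addr0.
  apply: (same _ (S \o F (i, z))) => // [|j]; first exact: subalgebraM.
  by rewrite /= !Fy; case: eqP => // _; rewrite (lin0 (A_linear AS)).
exists l; rewrite -[LHS](same (fun x => \sum_i F (i, y i) x)) //.
- by apply: eq_bigr => i _; rewrite lP.
- exact: A_sum.
move=> j; rewrite (bigD1 j)//= Fy eqxx big1 ?addr0// => i ij.
by rewrite Fy eq_sym (negbTE ij).
Qed.

(** Induction on [k]: [S0] is right on the tail, [S1] kills the tail but not the head, and [S2]
    carries the image of the head under [S1] to the error left by [S0]. Then [S0 + S2 S1] is right
    everywhere. *)
Lemma density k (y z : dsum H k) : lin_indep y ->
  exists2 S, A S & forall i, S (y i) = z i.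
Proof.
elim: k y z => [|k IH] y z iy.
  by exists id => // -[].
pose y' : dsum H k := [ffun i => y (lift ord0 i)].
have yE : y = dcons (y ord0) y'.
  apply/ffunP => i.
  by case: (unliftP ord0 i) => [j|] ->; rewrite ?dconsS ?dcons0 ?ffunE.
have [iy' yy'] : lin_indep y' /\ ~ span_of y' (y ord0).
  by apply: lin_indep_tail; rewrite -yE.
have [S0 AS0 S0y] := IH y' [ffun i => z (lift ord0 i)] iy'.
have [S1 AS1 [S1y S1u]] := annihilator_separates (fun w => IH y' w iy') yy'.
have [S2 AS2 S2u] := orbit_full S1u (z ord0 - S0 (y ord0)).
exists (fun x => S0 x + (S2 \o S1) x).
  by apply: A_add => //; exact: subalgebraM.
move=> i; case: (unliftP ord0 i) => [j|] -> /=; last by rewrite S2u addrC subrK.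
have := S0y j; have := S1y j; rewrite !ffunE => -> ->.
by rewrite (lin0 (A_linear AS2)) addr0.
Qed.

Theorem transitive_finite_dim_full : bounded_op H `<=` A.
Proof.
move=> T [lT _]; have [S AS ST] := density [ffun i => T (e i)] ie.
suff <- : S = T by [].
apply/funext => x; apply: (@lin_eq_span _ _ n e) (spane x) => //.
  exact: A_linear.
by move=> i; rewrite ST ffunE.
Qed.

End Burnside.

(** * Amplifications, closed orbits and their invariant subspace lattices *)

Section Amplifications.
Variables (R : realType) (H : hilbertType R) (n : nat).
Local Notation C := R[i].
Implicit Types (x y : dsum H n) (S T : H -> H) (A : set (H -> H)).

Lemma ampl_opmx T :
  T 0 = 0 -> ampl n T = opmx (fun i j => if i == j then T else fun=> 0).
Proof.
move=> T0; apply/funext => x; apply/ffunP => i; rewrite !ffunE.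
rewrite (bigD1 i)//= eqxx big1 ?addr0// => j ji.
by rewrite eq_sym (negbTE ji).
Qed.

Lemma ampl_bounded T : bounded_op H T -> bounded_op (dsum H n) (ampl n T).
Proof.
move=> bT; rewrite ampl_opmx; last by rewrite lin0//; case: bT.
rewrite -opmx_over_bounded_op.
exists (fun i j => if i == j then T else fun=> 0) => //.
by move=> i j; case: ifP => // _; exact: bounded_op0.
Qed.

Lemma scalar_opmx_bounded (P : dsum H n -> dsum H n) :
  opmx_over n (scalar_op H) P -> bounded_op (dsum H n) P.
Proof.
rewrite -opmx_over_bounded_op => -[B BP <-]; exists B => // i j.
by have [a ->] := BP i j; exact: scalar_bounded.
Qed.

Lemma scalar_opmx_ampl (P : dsum H n -> dsum H n) T x :
  opmx_over n (scalar_op H) P -> linear T -> P (ampl n T x) = ampl n T (P x).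
Proof.
move=> [B BP <-] lT; apply/ffunP => i; rewrite !ffunE lin_sum//.
by apply: eq_bigr => j _; have [a ->] := BP i j; rewrite ffunE linZ.
Qed.

Definition orbit A x : set (dsum H n) := [set ampl n S x | S in A].

Lemma closure_orbitP A x y : closure (orbit A x) y <->
  forall e : C, 0 < e -> exists2 S, A S & forall i, `|y i - S (x i)| < e.
Proof.
split=> [/closure_distP cy e e0|cy].
  have [_ [S AS <-] ye] := cy e e0; exists S => // i.
  apply: le_lt_trans ye.
  by have := dsum_coord_le (y - ampl n S x) i; rewrite !ffunE.
(* Dividing by [n.+1] instead of [n] allows [n = 0] and keeps the sum of [n] terms strictly below
   [e]. *)
apply/closure_distP => e e0; have e1 : 0 < e / n.+1%:R by rewrite divr_gt0.
have [S AS ye] := cy _ e1; exists (ampl n S x); first by exists S.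
apply: le_lt_trans (dsum_norm_le_sum _) _.
apply: (@le_lt_trans _ _ (\sum_(i < n) e / n.+1%:R)).
  by apply: ler_sum => i _; rewrite !ffunE ltW.
rewrite sumr_const card_ord -[ltLHS]mulr_natr -mulrA gtr_pMr// mulrC.
by rewrite ltr_pdivrMr// mul1r ltr_nat.
Qed.

Lemma orbit_closure_Lat A x : subalgebra A ->
  Lat (ampl n @` A) (closure (orbit A x)).
Proof.
move=> sA; have sO : lin_subspace (orbit A x).
  split=> [|a _ _ [S AS <-] [T AT <-]].
    exists (fun=> 0); first exact: subalgebra0.
    by apply/ffunP => i; rewrite !ffunE.
  exists (fun v => a *: S v + T v); first exact: subalgebraP.
  by apply/ffunP => i; rewrite !ffunE.
have [c0 cP] := subspace_closure sO.
split=> [|_ [S AS <-] _ [y Oy <-]].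
  by split=> //; exact: closed_closure.
have bS := ampl_bounded (subalgebra_bounded sA AS).
apply: closureS (closure_image_bounded bS Oy) => _ [_ [T AT <-] <-].
exists (S \o T); first exact: subalgebraM.
by apply/ffunP => i; rewrite !ffunE.
Qed.

Lemma Lat_amplP A : subalgebra A ->
  Lat (ampl n @` A) = Lat (ampl n @` bounded_op H) <->
  Lat (ampl n @` A) `<=` Lat (ampl n @` bounded_op H).
Proof.
move=> sA; split=> [->//|AB]; apply/seteqP; split=> // M [cM MB]; split=> //.
by move=> _ [S AS <-]; apply: MB; exists S => //; exact: subalgebra_bounded AS.
Qed.

(** Since [id] is in [A], the closed orbit of [x] contains [x], so its invariance under [ampl n T]
    captures [ampl n T x]. Conversely, an invariant closed subspace contains the closed orbit of
    each of its points. *)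
Lemma Lat_orbitP A : subalgebra A -> A id ->
  Lat (ampl n @` A) = Lat (ampl n @` bounded_op H) <->
  forall x T, bounded_op H T -> closure (orbit A x) (ampl n T x).
Proof.
move=> sA Aid; rewrite Lat_amplP//; split=> [AB x T bT|cO M [cM MA]].
  have [_] := AB _ (orbit_closure_Lat x sA).
  move=> /(_ (ampl n T)); apply; first by exists T.
  exists x => //; apply: subset_closure; exists id => //.
  by apply/ffunP => i; rewrite !ffunE.
split=> // _ [T bT <-] _ [x Mx <-].
case: cM => _ _; apply; apply: closureS (cO x T bT) => _ [S AS <-].
by apply: (MA (ampl n S)); [exists S|exists x].
Qed.

Lemma projection_Lat A P : Lat_proj (ampl n @` A) P ->
  Lat (ampl n @` A) [set x | P x = x].
Proof.
move=> [[bP PP _] PA]; have [lP _] := bP; split=> [|_ [S AS <-] _ [x /= Px <-]].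
  split; [exact: lin0|by move=> a x y /= Px Py; rewrite lP Px Py|].
  exact: fixpoints_closed.
have := PA _ (ex_intro2 _ _ S AS erefl); move=> /(congr1 (@^~ x)).
by rewrite /= Px.
Qed.

Lemma ampl_rank_one_adjoint u v x y :
  inner (ampl n (rank_one u v) x) y = inner x (ampl n (rank_one v u) y).
Proof.
apply: eq_bigr => i _; rewrite !ffunE innerZl innerZr [inner v _]innerC mulrC.
by [].
Qed.

Lemma Lat_projection_scalar P : projection P ->
  Lat (ampl n @` bounded_op H) [set x | P x = x] -> opmx_over n (scalar_op H) P.
Proof.
move=> [bP PP Padj] [_ Pinv].
have PTP u v x : P (ampl n (rank_one u v) (P x)) = ampl n (rank_one u v) (P x).
  apply: (Pinv (ampl n (rank_one u v))).
    by exists (rank_one u v) => //; exact: rank_one_bounded.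
  by exists (P x) => //=; exact: (congr1 (@^~ x) PP).
(* the adjoints of rank-one operators have rank one, so [PTP = TP] for all
   of them also gives [PTP = PT] *)
have PT u v x : P (ampl n (rank_one u v) x) = ampl n (rank_one u v) (P x).
  rewrite -PTP; apply: inner_inj => y.
  by rewrite !Padj !ampl_rank_one_adjoint Padj PTP.
have := bP; rewrite -opmx_over_bounded_op => -[B bB BP].
exists B => // i j; have [lB _] := bB i j.
apply: rank_one_commutant_scalar => // u v x.
(* Vectors supported at coordinate [j] isolate column [j] of the matrix; reading coordinate [i] then
   gives the entry [B i j]. *)
pose s z : dsum H n := [ffun k => if k == j then z else 0].
have Bs z : P (s z) i = B i j z.
  rewrite -BP ffunE (bigD1 j)//= ffunE eqxx big1 ?addr0// => k kj.
  by rewrite ffunE (negbTE kj) lin0//; have [] := bB i k.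
have Ts : ampl n (rank_one u v) (s x) = s (rank_one u v x).
  apply/ffunP => k; rewrite !ffunE; case: eqP => // _.
  by rewrite /rank_one linear0l scale0r.
by rewrite -!Bs -Ts PT ffunE.
Qed.

(** For the converse, the projection [P] onto an invariant [M] is a scalar matrix, so it commutes
    with [ampl n T]; for [x] in [M] this gives [ampl n T x = P (ampl n T x)], a point of [M]. *)
Lemma Lat_proj_scalarP A : subalgebra A ->
  Lat (ampl n @` A) = Lat (ampl n @` bounded_op H) <->
  forall P, Lat_proj (ampl n @` A) P -> opmx_over n (scalar_op H) P.
Proof.
move=> sA; split=> [AB P PA|AP].
  apply: Lat_projection_scalar; first by case: PA.
  by rewrite -AB; exact: projection_Lat.
apply/Lat_amplP => // M [cM MA]; split=> // _ [T [lT _] <-] _ [x Mx <-].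
have [P [pP MP Pid]] := projection_onto cM.
have sP : opmx_over n (scalar_op H) P.
  apply: AP; split=> // f Af; apply/funext => y /=.
  by apply/Pid/(MA _ Af); exists (P y).
by rewrite -(Pid _ Mx) -scalar_opmx_ampl.
Qed.

Lemma n_fold_LatP A : transitive_algebra A ->
  n_fold_transitive n A <-> Lat (ampl n @` A) = Lat (ampl n @` bounded_op H).
Proof.
move=> tA; have [sA Aid _] := tA.
rewrite Lat_orbitP//; split=> [nA x T bT|cO x ix]; last first.
  apply/seteqP; split=> // y _; have [w xw] := dual_family ix.
  (* Independence lets a bounded operator carry [x] to an arbitrary [y], so the closed orbit of [x]
     is everything. *)
  suff <- : ampl n (finite_rank w y) x = y by exact/cO/finite_rank_bounded.
  by apply/ffunP => i; rewrite ffunE finite_rank_interp.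
have [k [y [kn iy yx]]] := reduce_family x.
have [//|m [z [iz _ zy mz]]] := extend_family (V := setT) kn iy.
have zx i : span_of z (x i) by exact: span_of_trans (yx i).
case: mz => [mn|zT]; last first.
  (* Here [z] spans [H], so Burnside's theorem puts [T] itself in [A]. *)
  apply: subset_closure; exists T => //.
  by apply: (transitive_finite_dim_full tA iz) => // v; exact: zT.
subst m; have {zx}/choice[c xc] := zx.
(* The matrix of coefficients of [x] over the independent [n]-tuple [z] transports the approximation
   of [ampl n T z] to one of [ampl n T x]. *)
pose L := opmx (fun i j (v : H) => c i j *: v).
have oL : opmx_over n (scalar_op H) L.
  by exists (fun i j v => c i j *: v) => // i j; exists (c i j).
have Lz : L z = x by apply/ffunP => i; rewrite ffunE xc.
have [lT _] := bT; rewrite -Lz -scalar_opmx_ampl//.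
have : closure (orbit A z) (ampl n T z) by rewrite [closure _]nA.
move=> /(closure_image_bounded (scalar_opmx_bounded oL)).
apply: closureS => _ [_ [S AS <-] <-]; exists S => //.
by rewrite scalar_opmx_ampl//; have [] := subalgebra_bounded sA AS.
Qed.

End Amplifications.

(** * The strong closure through closed orbits in all finite direct sums *)

Section StrongClosure.
Variables (R : realType) (H : hilbertType R).
Local Notation C := R[i].
Implicit Types (S T : H -> H) (A : set (H -> H)).

Lemma ptws_near (U : eqType) (K : normedModType C)
    (f : {ptws U -> K}) (x : U) (e : C) :
  0 < e -> nbhs f [set g : {ptws U -> K} | `|f x - g x| < e].
Proof.
move=> e0.
have /(_ _ (nbhsx_ballx (f x) e e0)) := @proj_continuous U (fun=> K) x f.
by rewrite -ball_normE.
Qed.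

Lemma ptws_closure_distP (U : topologicalType) (K : normedModType C)
    (A : set {ptws U -> K}) (f : {ptws U -> K}) :
  closure A f <->
  forall n (x : 'I_n -> U) (e : C), 0 < e ->
    exists2 g, A g & forall i, `|f (x i) - g (x i)| < e.
Proof.
split=> [cf n x e e0|fA].
  have fn : nbhs f
      [set g : {ptws U -> K} | forall i, `|f (x i) - g (x i)| < e].
    apply: (@filter_forall _ _ (fun i => [set g | `|f (x i) - g (x i)| < e])
      _ (nbhs_filter f)) => i.
    exact: ptws_near.
  by have [g [Ag fg]] := cf _ fn; exists g.
(* Indexed by a finite list of points and a tolerance, these sets generate a filter of members of
   [A] converging pointwise to [f]. *)
pose B (p : seq U * R) :=
  [set g | A g /\ forall x, x \in p.1 -> `|f x - g x| < p.2%:C%C].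
pose F := filter_from [set p : seq U * R | 0 < p.2] B.
have B0 p : 0 < p.2 -> B p !=set0.
  move: p => [s e] /= e0; have ec : 0 < e%:C%C by rewrite ltcR.
  have [g Ag fg] := fA _ (tnth (in_tuple s)) _ ec.
  exists g; split=> // x /= /(tnthP (in_tuple s))[i ->].
  exact: fg.
have FF : ProperFilter F.
  apply: filter_from_proper => //; apply: filter_from_filter.
    by exists ([::], 1) => /=.
  move=> [s e] [t d] /= e0 d0; exists (s ++ t, Num.min e d).
    by rewrite /= lt_min e0.
  move=> g [Ag fg]; split; split=> // x xs; (apply: lt_le_trans (fg x _) _;
    [by rewrite mem_cat xs ?orbT|by rewrite lecR ge_min lexx ?orbT]).
have Ff : {ptws, F --> f}.
  apply/pointwise_cvgP => x; apply/cvgrPdist_lt => e e0.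
  exists ([:: x], complex.Re e).
    by rewrite /= -ltcR RRe_real// gtr0_real.
  move=> g [_ /(_ x)]/=; rewrite mem_head RRe_real ?gtr0_real//.
  exact.
move=> V /Ff[p p0 BV]; have [g Bg] := B0 p p0.
by exists g; split; [case: Bg|exact: BV].
Qed.

(** Pointwise approximation tests finitely many vectors at a time, and these are the coordinates of
    a single vector of a direct sum. *)
Lemma strong_closure_orbitP A T : @closure {ptws H -> H} A T <->
  forall n (x : dsum H n), closure (orbit A x) (ampl n T x).
Proof.
rewrite ptws_closure_distP; split=> [TA n x|cO n x e e0].
  apply/closure_orbitP => e e0; have [S AS ST] := TA n x e e0.
  by exists S => // i; rewrite ffunE.
have /closure_orbitP/(_ e e0)[S AS ST] := cO n [ffun i => x i].
by exists S => // i; have := ST i; rewrite !ffunE.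
Qed.

Lemma strong_closure_LatP A : subalgebra A -> A id ->
  strong_closure A = bounded_op H <->
  forall n, Lat (ampl n @` A) = Lat (ampl n @` bounded_op H).
Proof.
move=> sA Aid; split=> [cA n|AB].
  apply/Lat_orbitP => // x T.
  by rewrite -cA => -[_ /strong_closure_orbitP]; exact.
apply/seteqP; split=> [T []//|T bT]; split=> //.
apply/strong_closure_orbitP => n x; exact: (proj1 (Lat_orbitP n sA Aid) (AB n)).
Qed.

End StrongClosure.

Theorem proposition1p3 (R : realType) (H : hilbertType R) (A : set (H -> H)) :
  transitive_algebra A ->
  (forall n : nat,
    (n_fold_transitive n A <->
       Lat (ampl n @` A) = Lat (ampl n @` bounded_op H)) /\
    (Lat (ampl n @` A) = Lat (ampl n @` bounded_op H) <->
       forall P : dsum H n -> dsum H n,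
         Lat_proj (ampl n @` A) P -> opmx_over n (scalar_op H) P)) /\
  (strong_closure A = bounded_op H <->
    forall n : nat, Lat (ampl n @` A) = Lat (ampl n @` bounded_op H)).
Proof.
move=> tA; have [sA Aid _] := tA.
split=> [n|]; last exact: strong_closure_LatP.
by split; [exact: n_fold_LatP|exact: Lat_proj_scalarP].
Qed.
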